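(* For every integer $m\ge 0$, $$g^{\mathrm{asc}}_{R,\mathrm{PFA}}(m)=\begin{cases}\{0\}, & \text{if } m=0,\\ \{1\}, & \text{if } m=1,\\ \mathbb{N}_{\ge 2}, & \text{if } m\ge 2,\end{cases}$$ where $\mathbb{N}_{\ge 2}$ is the set of all integers $\ge 2$.
   Context: All automata are deterministic and complete. A DFA is a tuple $A=(Q,\Sigma,\cdot,s,F)$ with finite state set $Q$, finite alphabet $\Sigma$, transition function $\cdot:Q\times\Sigma\to Q$ (extended to words in the usual way), initial state $s\in Q$ and final states $F\subseteq Q$; $L(A)=\{w\in\Sigma^*\mid s\cdot w\in F\}$. A permutation automaton is a DFA in which, for every $a\in\Sigma$, the map $q\mapsto q\cdot a$ is a permutation of $Q$. For a regular language $L$, $\mathrm{asc}(L)$ is the minimum number of final states among all DFAs accepting $L$. For $K\subseteq\Sigma^*$, $K^R=\{w^R\mid w\in K\}$, where $w^R$ is the reversal of the word $w$. For $m\ge 0$, $g^{\mathrm{asc}}_{R,\mathrm{PFA}}(m)$ is the set of all integers $\alpha\ge 0$ for which there exists a language $K$ (over some finite alphabet) accepted by a permutation automaton with $\mathrm{asc}(K)=m$ and $\mathrm{asc}(K^R)=\alpha$. *)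

(* Defs.v *)
From mathcomp Require Import all_boot.
From mathcomp Require Import boolp classical_sets.

Set Implicit Arguments.
Unset Strict Implicit.
Unset Printing Implicit Defensive.

Local Open Scope classical_set_scope.

Record dfa (Sigma : finType) := Dfa {
  dfa_state : finType;
  dfa_step : dfa_state -> Sigma -> dfa_state;
  dfa_init : dfa_state;
  dfa_final : {set dfa_state}
}.

Definition dfa_run (Sigma : finType) (A : dfa Sigma) (q : dfa_state A)
    (w : seq Sigma) : dfa_state A :=
  foldl (@dfa_step Sigma A) q w.

Definition dfa_lang (Sigma : finType) (A : dfa Sigma) : set (seq Sigma) :=
  [set w | dfa_run (dfa_init A) w \in dfa_final A].

Definition is_pfa (Sigma : finType) (A : dfa Sigma) : Prop :=
  forall a : Sigma, bijective (fun q : dfa_state A => dfa_step q a).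

Definition accepting_counts (Sigma : finType) (L : set (seq Sigma)) : set nat :=
  [set n | exists A : dfa Sigma, dfa_lang A = L /\ #|dfa_final A| = n].

(* [is_asc L n] reads "L is regular and asc(L) = n".  It is a relation because
   asc is only defined on regular languages; the two lemmas below show that it
   is single-valued, and total on regular languages. *)
Definition is_asc (Sigma : finType) (L : set (seq Sigma)) (n : nat) : Prop :=
  accepting_counts L n /\ forall k, accepting_counts L k -> n <= k.

Lemma is_asc_unique (Sigma : finType) (L : set (seq Sigma)) (m n : nat) :
  is_asc L m -> is_asc L n -> m = n.
Proof.
move=> [Lm minm] [Ln minn]; apply/eqP.
by rewrite eqn_leq minm // minn.
Qed.

Lemma is_asc_exists (Sigma : finType) (A : dfa Sigma) :
  exists n, is_asc (dfa_lang A) n.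
Proof.
have exP : exists n, `[< accepting_counts (dfa_lang A) n >].
  by exists #|dfa_final A|; apply/asboolP; exists A.
case: (ex_minnP exP) => n /asboolP Ln minn; exists n; split=> // k Lk.
by apply: minn; apply/asboolP.
Qed.

Definition lang_rev (Sigma : finType) (K : set (seq Sigma)) : set (seq Sigma) :=
  [set rev w | w in K].

Definition g_asc_R_PFA (m : nat) : set nat :=
  [set alpha | exists (Sigma : finType) (K : set (seq Sigma)),
     [/\ exists A : dfa Sigma, is_pfa A /\ dfa_lang A = K,
         is_asc K m
       & is_asc (lang_rev K) alpha]].

(* Main.v *)
(** The count asc(L) is the number of left quotients of L by words of L, so
    asc(L) = 1 says that these quotients all coincide.  When L is accepted by a
    permutation automaton, every word has an inverse word, which turns this
    into the same statement about right quotients; hence asc(L) = 1 iff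
    asc(L^R) = 1.  Conversely, let H and K be subgroups of orders alpha and m
    of a finite group, with [k h \notin H K] whenever [k] and [h] are
    nontrivial.  Over the alphabet of all group elements, the words whose
    product lies in H K have |K| quotients (the cosets H k) and their reversals
    have |H| (the cosets h K).  Such H and K are obtained by letting two groups
    act by translation on one row and on one column of a grid. *)

Require Import Defs.
From mathcomp Require Import all_boot all_fingroup zmodp.
From mathcomp Require Import boolp classical_sets.

Local Open Scope classical_set_scope.

Set Implicit Arguments.
Unset Strict Implicit.
Unset Printing Implicit Defensive.

(** * Minimal numbers of final states, and quotients *)

Section Automata.
Local Open Scope group_scope.
Variable Sigma : finType.
Implicit Types (A B : dfa Sigma) (L : set (seq Sigma)) (u v w z : seq Sigma).

Lemma dfa_run_cat A (q : dfa_state A) u v :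
  dfa_run q (u ++ v) = dfa_run (dfa_run q u) v.
Proof. exact: foldl_cat. Qed.

Lemma dfa_langE A w : dfa_lang A w = (dfa_run (dfa_init A) w \in dfa_final A).
Proof. by []. Qed.

(** Following a word that reaches it, each final state of [A] yields a final state of any equivalent
    [B]. Two of them cannot meet in [B], since [z] would then be accepted after both or after
    neither. *)
Lemma is_asc_trim_reduced A :
  (forall q, q \in dfa_final A -> exists w, dfa_run (dfa_init A) w = q) ->
  (forall p q, p \in dfa_final A -> q \in dfa_final A -> p != q ->
     exists z, dfa_run p z \in dfa_final A /\ dfa_run q z \notin dfa_final A) ->
  is_asc (dfa_lang A) #|dfa_final A|.
Proof.
move=> reach dist; split=> [|_ [B [BA <-]]]; first by exists A.
pose word q := xget [::] [set w | dfa_run (dfa_init A) w = q].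
have wordP q : q \in dfa_final A -> dfa_run (dfa_init A) (word q) = q.
  by move=> /reach; exact: (@xgetPex _ [::] [set w | dfa_run (dfa_init A) w = q]).
have memE w : (dfa_run (dfa_init B) w \in dfa_final B) =
              (dfa_run (dfa_init A) w \in dfa_final A).
  by apply/idP/idP; rewrite -!dfa_langE BA.
pose f q := dfa_run (dfa_init B) (word q).
rewrite -(@card_in_imset _ _ f (dfa_final A)); last first.
  move=> p q pF qF fpq; apply/eqP/negP => /negP /(dist _ _ pF qF)[z []].
  rewrite -{1}(wordP _ pF) -{1}(wordP _ qF) -!dfa_run_cat -!memE !dfa_run_cat.
  by rewrite -/(f p) -/(f q) fpq => ->.
apply/subset_leq_card/fintype.subsetP => _ /imsetP[q qF ->].
by rewrite memE wordP.
Qed.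

Lemma lang_revE L w : lang_rev L w <-> L (rev w).
Proof.
split=> [[u Lu <-]|Lw]; first by rewrite revK.
by exists (rev w) => //; rewrite revK.
Qed.

Lemma lang_revK L : lang_rev (lang_rev L) = L.
Proof. by apply/seteqP; split=> w; rewrite !lang_revE revK. Qed.

Lemma lang_rev0 : lang_rev set0 = set0 :> set (seq Sigma).
Proof. exact: image_set0. Qed.

Definition dfa0 : dfa Sigma :=
  @Dfa Sigma unit (fun q _ => q) tt finset.set0.

Lemma dfa0_lang : dfa_lang dfa0 = set0.
Proof. by apply/seteqP; split=> w //; rewrite dfa_langE inE. Qed.

Lemma is_asc_set0 : is_asc (set0 : set (seq Sigma)) 0.
Proof. by split=> //; exists dfa0; rewrite dfa0_lang cards0. Qed.

Lemma is_asc0 L : is_asc L 0 -> L = set0.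
Proof.
case=> [[A [<- /eqP F0]] _]; move: F0; rewrite cards_eq0 => /eqP F0.
by apply/seteqP; split=> w //; rewrite dfa_langE F0 inE.
Qed.

Lemma is_asc1_lquotient L u v z :
  is_asc L 1 -> L u -> L v -> L (u ++ z) -> L (v ++ z).
Proof.
case=> [[A [<- /eqP/cards1P[f Ff]]] _]; rewrite !dfa_langE Ff !dfa_run_cat.
by rewrite !inE => /eqP-> /eqP->.
Qed.

(** A word acts as a permutation of finite order, so repeating the word itself undoes it. *)
Lemma pfa_inv_word A u : is_pfa A ->
  exists u', forall q : dfa_state A, dfa_run q (u ++ u') = q.
Proof.
move=> pfaA.
have runI w : injective (fun q : dfa_state A => dfa_run q w).
  elim: w => [|a w IHw] p q //= /IHw; exact: (bij_inj (pfaA a)).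
pose g := perm (@runI u).
have runX n q : dfa_run q (flatten (nseq n u)) = (g ^+ n) q.
  elim: n q => [|n IHn] q; first by rewrite expg0 perm1.
  by rewrite expgS permM permE /= dfa_run_cat IHn.
exists (flatten (nseq #[g].-1 u)) => q.
have -> : u ++ flatten (nseq #[g].-1 u) = flatten (nseq #[g].-1.+1 u) by [].
by rewrite runX prednK ?order_gt0 // expg_order perm1.
Qed.

Lemma is_asc1_rquotient A u v z : is_pfa A -> is_asc (dfa_lang A) 1 ->
  dfa_lang A u -> dfa_lang A v -> dfa_lang A (z ++ u) -> dfa_lang A (z ++ v).
Proof.
move=> pfaA asc1 Lu Lv Lzu; have [u' uu'] := pfa_inv_word u pfaA.
(* [v] acts as [u ++ u' ++ v], so [u' ++ v] extends [u], hence [z ++ u], into the language. *)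
have: dfa_lang A (u ++ (u' ++ v)).
  by rewrite dfa_langE catA dfa_run_cat uu'.
move/(is_asc1_lquotient asc1 Lu Lzu).
by rewrite !dfa_langE -catA (catA u) !dfa_run_cat -(dfa_run_cat _ u) uu'.
Qed.

(** * Reversal of permutation automata *)

Definition dfa_rev A : dfa Sigma :=
  @Dfa Sigma {set dfa_state A}
    (fun S a => [set q | dfa_step q a \in S]%SET) (dfa_final A)
    [set S : {set dfa_state A} | dfa_init A \in S]%SET.

Lemma dfa_rev_lang A : dfa_lang (dfa_rev A) = lang_rev (dfa_lang A).
Proof.
have runE w (S : {set dfa_state A}) q :
    (q \in dfa_run (S : dfa_state (dfa_rev A)) w) = (dfa_run q (rev w) \in S).
  elim: w S q => [|a w IHw] S q //=.
  by rewrite IHw inE rev_cons -cats1 dfa_run_cat.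
apply/seteqP; split=> w; rewrite lang_revE !dfa_langE inE runE; exact.
Qed.

(** Taking preimages under a surjective map is injective on subsets. *)
Lemma dfa_rev_pfa A : is_pfa A -> is_pfa (dfa_rev A).
Proof.
move=> pfaA a; apply: (@injF_bij {set dfa_state A}) => S1 S2 /setP eqS; apply/setP => q.
have [f _ fK] := pfaA a.
by have := eqS (f q); rewrite !inE fK.
Qed.

Definition reachable A (q : dfa_state A) : bool :=
  `[< exists w, dfa_run (dfa_init A) w = q >].

Lemma reachableP A (q : dfa_state A) :
  reflect (exists w, dfa_run (dfa_init A) w = q) (reachable q).
Proof. exact: asboolP. Qed.

(* The reversal automaton on sets of reachable states, so that two words of the
   reversed language lead to the same set as soon as they have the same
   right quotients; [u] is any word of the language. *)
Definition dfa_rev1 A u : dfa Sigma :=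
  @Dfa Sigma {set dfa_state A}
    (fun S a => [set q | reachable q && (dfa_step q a \in S)]%SET)
    [set q in dfa_final A | reachable q]%SET
    [set [set q : dfa_state A | reachable q && (dfa_run q u \in dfa_final A)]]%SET.

Lemma dfa_rev1_run A u w :
  dfa_run (dfa_init (dfa_rev1 A u)) w =
  [set q : dfa_state A | reachable q && (dfa_run q (rev w) \in dfa_final A)]%SET.
Proof.
elim/last_ind: w => [|w a IHw]; first by apply/setP=> q; rewrite !inE andbC.
rewrite -cats1 dfa_run_cat IHw rev_cat; apply/setP => q; rewrite !inE /=.
case: reachableP => //= -[z zq].
suff -> : reachable (dfa_step q a) by [].
by apply/reachableP; exists (z ++ [:: a]); rewrite dfa_run_cat zq.
Qed.

Lemma is_asc1_rev A : is_pfa A -> is_asc (dfa_lang A) 1 ->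
  is_asc (lang_rev (dfa_lang A)) 1.
Proof.
move=> pfaA asc1.
have [u Lu] : exists u, dfa_lang A u.
  apply: contrapT => noL; have L0 : dfa_lang A = set0.
    by apply/seteqP; split=> w // Lw; case: noL; exists w.
  by move: asc1; rewrite L0 => /is_asc_unique/(_ is_asc_set0).
split=> [|[|//] [B [BL /eqP]]]; last first.
  rewrite cards_eq0 => /eqP B0.
  have: dfa_lang B (rev u) by rewrite BL lang_revE revK.
  by rewrite dfa_langE B0 inE.
exists (dfa_rev1 A u); split; last by rewrite cards1.
apply/seteqP; split=> w; rewrite lang_revE (dfa_langE (dfa_rev1 A u)) dfa_rev1_run inE.
  move=> /eqP/setP/(_ (dfa_init A)); rewrite !inE => eqS.
  have ri : reachable (dfa_init A) by apply/reachableP; exists [::].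
  by move: eqS; rewrite ri /= dfa_langE => ->.
(* At a state reached by [z], equality of the sets means that [z ++ rev w] and [z ++ u] are accepted
   together. *)
move=> Lw; apply/eqP/setP => q; rewrite !inE.
case: reachableP => //= -[z <-]; rewrite -!dfa_run_cat.
by apply/idP/idP; apply: (is_asc1_rquotient pfaA asc1).
Qed.

(** [dfa_rev A] is again a permutation automaton, so [is_asc1_rev] applies to it, and reversing
    twice restores the language. *)
Lemma is_asc1_revE A n : is_pfa A -> is_asc (dfa_lang A) n ->
  is_asc (lang_rev (dfa_lang A)) 1 -> n = 1%N.
Proof.
move=> pfaA ascn; rewrite -dfa_rev_lang => /(is_asc1_rev (dfa_rev_pfa pfaA)).
by rewrite dfa_rev_lang lang_revK; apply: is_asc_unique.
Qed.

Lemma is_asc_rev0 L n : is_asc L n -> is_asc (lang_rev L) 0 -> n = 0%N.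
Proof.
move=> ascn /is_asc0 L0; move: ascn.
by rewrite -(lang_revK L) L0 lang_rev0 => /is_asc_unique/(_ is_asc_set0).
Qed.

End Automata.

(** * Words whose product lies in [H * K] *)

Section ProductLanguage.
Local Open Scope group_scope.
Variables (gT : finGroupType) (H K : {group gT}).

(** All subsets serve as states so that letters permute them; only right cosets of [H] are
    reached. *)
Definition rcoset_dfa : dfa gT :=
  @Dfa gT {set gT} (fun S a => S :* a) (H : {set gT}) (rcosets H K).

Definition lcoset_dfa : dfa gT :=
  @Dfa gT {set gT} (fun S a => a *: S) (K : {set gT}) (lcosets K H).

Lemma rcoset_dfa_run S w :
  dfa_run (S : dfa_state rcoset_dfa) w = S :* \prod_(a <- w) a.
Proof.
elim: w S => [|a w IHw] S; first by rewrite big_nil mulg1.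
by rewrite big_cons rcosetM -IHw.
Qed.

Lemma lcoset_dfa_run S w :
  dfa_run (S : dfa_state lcoset_dfa) w = (\prod_(a <- rev w) a) *: S.
Proof.
elim: w S => [|a w IHw] S; first by rewrite big_nil mul1g.
by rewrite rev_cons -cats1 big_cat big_seq1 lcosetM -IHw.
Qed.

Lemma rcoset_dfa_final w :
  (dfa_run (dfa_init rcoset_dfa) w \in dfa_final rcoset_dfa) =
  (\prod_(a <- w) a \in H * K).
Proof. by rewrite rcoset_dfa_run mem_rcosets. Qed.

Lemma lcoset_dfa_final w :
  (dfa_run (dfa_init lcoset_dfa) w \in dfa_final lcoset_dfa) =
  (\prod_(a <- rev w) a \in H * K).
Proof. by rewrite lcoset_dfa_run mem_lcosets. Qed.

Lemma rcoset_dfa_pfa : is_pfa rcoset_dfa.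
Proof.
move=> a; exists (fun S : {set gT} => S :* a^-1) => S /=.
  exact: rcosetK.
exact: rcosetKV.
Qed.

Lemma lcoset_dfa_lang : dfa_lang lcoset_dfa = lang_rev (dfa_lang rcoset_dfa).
Proof.
apply/seteqP; split=> w;
  rewrite lang_revE !dfa_langE lcoset_dfa_final rcoset_dfa_final; exact.
Qed.

Hypothesis HKfree : forall h k, h \in H -> k \in K -> k * h \in H * K ->
  k = 1 \/ h = 1.

Lemma rcoset_dfa_asc : H :&: K = 1 -> (1 < #|H|)%N ->
  is_asc (dfa_lang rcoset_dfa) #|K|.
Proof.
move=> tiHK; rewrite cardG_gt1 => /trivgPn[h hH h1].
have -> : #|K| = #|dfa_final rcoset_dfa|.
  by rewrite -/(indexg K H) -divgI finset.setIC tiHK cards1 divn1.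
apply: is_asc_trim_reduced => [_ /rcosetsP[k kK ->]|].
  by exists [:: k]; rewrite rcoset_dfa_run big_seq1.
move=> _ _ /rcosetsP[k1 Kk1 ->] /rcosetsP[k2 Kk2 ->] neq.
(* This word leads from [H :* k1] to [H :* h], which is [H] and final, and from [H :* k2] to
   [H :* (k2 * k1^-1 * h)], final only if [k2 = k1] or [h = 1]. *)
exists [:: k1^-1; h]; rewrite !rcoset_dfa_run -!rcosetM !mem_rcosets.
rewrite !big_cons big_nil mulg1 mulKVg mulgA; split.
  by rewrite -[h]mulg1 mem_mulg ?group1.
apply/negP => /(HKfree hH (groupM Kk2 (groupVr Kk1)))[] /eqP.
  by rewrite -eq_mulgV1 => /eqP E; rewrite E eqxx in neq.
exact/negP.
Qed.

Lemma lcoset_dfa_asc : H :&: K = 1 -> (1 < #|K|)%N ->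
  is_asc (dfa_lang lcoset_dfa) #|H|.
Proof.
move=> tiHK; rewrite cardG_gt1 => /trivgPn[k kK k1].
have -> : #|H| = #|dfa_final lcoset_dfa|.
  by rewrite card_lcosets -divgI tiHK cards1 divn1.
apply: is_asc_trim_reduced => [_ /lcosetsP[h hH ->]|].
  by exists [:: h]; rewrite lcoset_dfa_run big_seq1.
move=> _ _ /lcosetsP[h1 Hh1 ->] /lcosetsP[h2 Hh2 ->] neq.
(* Letters multiply on the left: [h1 *: K] goes to [k *: K], which is [K], and [h2 *: K] to
   [(k * h1^-1 * h2) *: K]. *)
exists [:: h1^-1; k]; rewrite !lcoset_dfa_run -!lcosetM !mem_lcosets.
rewrite -[rev _]/[:: k; h1^-1] big_cons big_seq1 mulgKV -mulgA; split.
  by rewrite -[k]mul1g mem_mulg ?group1.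
apply/negP => /(HKfree (groupM (groupVr Hh1) Hh2) kK)[] /eqP.
  exact/negP.
by rewrite -eq_mulVg1 => /eqP E; rewrite E eqxx in neq.
Qed.

End ProductLanguage.

(** * Two groups acting on a grid *)

Section Grid.
Local Open Scope group_scope.
Variables gT1 gT2 : finGroupType.
Local Notation T := (gT1 * gT2)%type.

(** The row and the column share only the corner [(1, 1)], whose image determines the
    translation. *)
Definition row_fun (x : gT1) (p : T) : T :=
  if p.2 == 1 then (p.1 * x, p.2) else p.

Definition col_fun (y : gT2) (p : T) : T :=
  if p.1 == 1 then (p.1, p.2 * y) else p.

Lemma row_fun_inj x : injective (row_fun x).
Proof.
apply: (can_inj (g := row_fun x^-1)) => -[a b]; rewrite /row_fun /=.
by case E: (b == 1) => /=; rewrite E ?mulgK.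
Qed.

Lemma col_fun_inj y : injective (col_fun y).
Proof.
apply: (can_inj (g := col_fun y^-1)) => -[a b]; rewrite /col_fun /=.
by case E: (a == 1) => /=; rewrite E ?mulgK.
Qed.

Definition row_perm x : {perm T} := perm (@row_fun_inj x).
Definition col_perm y : {perm T} := perm (@col_fun_inj y).

Lemma row_permM : {in [set: gT1]%SET &, {morph row_perm : x y / x * y}}.
Proof.
move=> x y _ _; apply/permP => -[a b]; rewrite permM !permE /row_fun /=.
by case E: (b == 1) => /=; rewrite E ?mulgA.
Qed.

Lemma col_permM : {in [set: gT2]%SET &, {morph col_perm : x y / x * y}}.
Proof.
move=> x y _ _; apply/permP => -[a b]; rewrite permM !permE /col_fun /=.
by case E: (a == 1) => /=; rewrite E ?mulgA.
Qed.

Canonical row_morphism := Morphism row_permM.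
Canonical col_morphism := Morphism col_permM.

Definition row_group := (row_perm @* [set: gT1]%SET)%G.
Definition col_group := (col_perm @* [set: gT2]%SET)%G.

Lemma row_perm1 x : row_perm x (1, 1) = (x, 1).
Proof. by rewrite permE /row_fun /= eqxx mul1g. Qed.

Lemma col_perm1 y : col_perm y (1, 1) = (1, y).
Proof. by rewrite permE /col_fun /= eqxx mul1g. Qed.

Lemma card_row_group : #|row_group| = #|gT1|.
Proof.
rewrite card_injm ?cardsT //; apply/injmP => x y _ _ /= E.
by have := row_perm1 x; rewrite E row_perm1 => -[].
Qed.

Lemma card_col_group : #|col_group| = #|gT2|.
Proof.
rewrite card_injm ?cardsT //; apply/injmP => x y _ _ /= E.
by have := col_perm1 x; rewrite E col_perm1 => -[].
Qed.

Lemma row_groupP g : reflect (exists x, g = row_perm x) (g \in row_group).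
Proof.
apply: (iffP morphimP) => [[x _ _ ->]|[x ->]]; first by exists x.
by exists x; rewrite ?inE.
Qed.

Lemma col_groupP g : reflect (exists y, g = col_perm y) (g \in col_group).
Proof.
apply: (iffP morphimP) => [[x _ _ ->]|[x ->]]; first by exists x.
by exists x; rewrite ?inE.
Qed.

Lemma row_colI : row_group :&: col_group = 1.
Proof.
apply/trivgP/fintype.subsetP => g; rewrite !inE.
move=> /andP[/row_groupP[x ->] /col_groupP[y E]].
(* A common element sends the corner into both the row and the column, hence to itself. *)
have := row_perm1 x; rewrite E col_perm1 => -[_ y1].
by rewrite y1 (morph1 col_morphism).
Qed.

(* Compare the images of the corner (1, 1), which [k * h] sends inside the
   column and [h' * k'] inside the row unless [h'] is trivial. *)
Lemma row_col_free h k : h \in row_group -> k \in col_group ->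
  k * h \in row_group * col_group -> k = 1 \/ h = 1.
Proof.
move=> hR kC /mulsgP[h' k' h'R k'C E].
have [y ky] := col_groupP _ kC; have [y1|y1] := eqVneq y 1.
  by left; rewrite ky y1 (morph1 col_morphism).
right; have [x' hx'] := row_groupP _ h'R; have [x ex] := row_groupP _ hR.
(* If [h'] is trivial, [h] equals [k^-1 * k'] and lies in both groups. *)
have [x1|x1] := eqVneq x' 1.
  apply/set1gP; rewrite -row_colI inE hR /=.
  have -> : h = k^-1 * k'.
    by rewrite -[h](mulKg k) E hx' x1 (morph1 row_morphism) mul1g.
  by rewrite groupM ?groupV.
have /permP/(_ (1, 1)) := E; rewrite !permM ky hx' row_perm1 col_perm1.
have [y' ->] := col_groupP _ k'C; rewrite ex !permE /row_fun /col_fun /=.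
by rewrite (negbTE y1) (negbTE x1) => -[E1]; rewrite E1 eqxx in x1.
Qed.

End Grid.

(** * Attained and excluded values *)

Lemma g_asc_R_PFA_ge2 (m n : nat) :
  (1 < m)%N -> (1 < n)%N -> g_asc_R_PFA m n.
Proof.
case: m n => [//|m] [//|n] m1 n1.
(* Cyclic groups of the two orders: [H] fixes the count of the reversal, [K] that of the
   language. *)
pose H := row_group 'I_n.+1 'I_m.+1; pose K := col_group 'I_n.+1 'I_m.+1.
have cH : #|H| = n.+1 by rewrite card_row_group card_ord.
have cK : #|K| = m.+1 by rewrite card_col_group card_ord.
exists _, (dfa_lang (rcoset_dfa H K)); split.
- by exists (rcoset_dfa H K); split=> //; apply: rcoset_dfa_pfa.
- rewrite -cK; apply: rcoset_dfa_asc (@row_col_free _ _) (row_colI _ _) _.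
  by rewrite cH.
- rewrite -lcoset_dfa_lang -cH.
  apply: lcoset_dfa_asc (@row_col_free _ _) (row_colI _ _) _.
  by rewrite cK.
Qed.

Lemma g_asc_R_PFA_00 : g_asc_R_PFA 0 0.
Proof.
exists unit, set0; rewrite lang_rev0; split; [|exact: is_asc_set0..].
by exists (dfa0 unit); split; [move=> a; exists id | exact: dfa0_lang].
Qed.

Definition dfa_all : dfa unit := @Dfa unit unit (fun q _ => q) tt [set: unit]%SET.

Lemma g_asc_R_PFA_11 : g_asc_R_PFA 1 1.
Proof.
have pfa_all : is_pfa dfa_all by move=> a; exists id.
have asc_all : is_asc (dfa_lang dfa_all) 1.
  have <- : #|dfa_final dfa_all| = 1%N by rewrite cardsT card_unit.
  by apply: is_asc_trim_reduced => [[] _|[] []] //; exists [::].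
exists unit, (dfa_lang dfa_all); split=> //; first by exists dfa_all.
exact: is_asc1_rev.
Qed.

Theorem corollary1 (m : nat) :
  g_asc_R_PFA m =
    if m == 0 then [set 0]
    else if m == 1 then [set 1]
    else [set k : nat | 2 <= k].
Proof.
apply/seteqP; split=> n.
  move=> [Sigma [L [[A [pfaA <-]] ascm ascn]]].
  case: eqP ascm => [-> /is_asc0 L0|m0 ascm].
    by move: ascn; rewrite L0 lang_rev0 => /is_asc_unique; apply; apply: is_asc_set0.
  case: eqP ascm => [-> ascm|m1 ascm].
    exact: is_asc_unique ascn (is_asc1_rev pfaA ascm).
  (* A count of 0 or 1 for the reversal would force the same count on the language. *)
  case: n ascn => [|[|n]] ascn //=.
    by case: m0; apply: is_asc_rev0 ascm ascn.
  by case: m1; apply: is_asc1_revE ascm ascn.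
case: m => [|[|m]] /= => [->|->|n2]; first exact: g_asc_R_PFA_00.
  exact: g_asc_R_PFA_11.
exact: g_asc_R_PFA_ge2.
Qed.
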